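(* Let $(a,b,c)\in\mathbb{K}$ satisfy $b\neq 0$ and $ab-c\neq 0$, and let $f(x)=\frac{x+a}{bx+c}$ for $x\in\mathbb{R}\setminus\{\hat x\}$ with $\hat x=-\frac{c}{b}$. Then: 1) If $(c-1)^2+4ab>0$, then for any $x\in\mathbb{R}\setminus(\mathrm{Fix}(f)\cup\mathcal{P})$, $$\lim_{n\to\infty}f^n(x)=\begin{cases}x_2, & \text{if } \left|\frac{\alpha}{\beta}\right|<1,\\ x_1, & \text{if } \left|\frac{\alpha}{\beta}\right|>1.\end{cases}$$ 2) If $(c-1)^2+4ab=0$, then for any $x\in\mathbb{R}\setminus(\mathrm{Fix}(f)\cup\mathcal{P})$, $\lim_{n\to\infty}f^n(x)=x_1=\frac{1-c}{2b}$. 3) If $(c-1)^2+4ab<0$, then for any $x\in\mathbb{R}\setminus(\mathrm{Fix}(f)\cup\mathcal{P})$ the trajectory $\{f^n(x)\}_{n\geq 1}$ is dense in $\mathbb{R}$.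
   Context: $f^n$ denotes the $n$-fold iterate of $f$ (with $f^0(x)=x$). $\mathrm{Fix}(f)=\{x: f(x)=x\}$. $\mathcal{P}=\{x\in\mathbb{R}:\ \exists n\in\mathbb{N}\cup\{0\},\ f^n(x)=\hat x\}$ is the set of points whose trajectory reaches the pole $\hat x$; for $x\notin\mathcal{P}$ all iterates are defined. $\alpha=\frac{1+c+\sqrt{(c-1)^2+4ab}}{2}$, $\beta=\frac{1+c-\sqrt{(c-1)^2+4ab}}{2}$ (complex conjugate when $(c-1)^2+4ab<0$). If $(c-1)^2+4ab\geq 0$: $x_1=\frac{1-c+\sqrt{(c-1)^2+4ab}}{2b}$, $x_2=\frac{1-c-\sqrt{(c-1)^2+4ab}}{2b}$ (these are the fixed points of $f$). For $q\geq 1$: $K_q(a,b,c)=\sum_{j=0}^{q-1}\alpha^{q-j-1}\beta^{j}$, and $\mathbb{K}_q=\{(a,b,c)\in\mathbb{R}^3: K_q(a,b,c)=0\}$. Finally $\mathbb{K}=\mathbb{R}^3\setminus\bigcup_{q=2}^{\infty}\mathbb{K}_q$. *)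

(* Defs.v *)
From HB Require Import structures.
From mathcomp Require Export all_boot all_order all_algebra.
From mathcomp Require Export all_classical all_reals all_analysis.
From mathcomp Require Export complex.

Set Implicit Arguments.
Unset Strict Implicit.
Unset Printing Implicit Defensive.

Export Order.TTheory GRing.Theory Num.Theory numFieldNormedType.Exports.

Local Open Scope classical_set_scope.
Local Open Scope ring_scope.
Local Open Scope complex_scope.

Definition pole {R : realType} (b c : R) : R := - (c / b).

(* Division is total, so [mobius a b c] takes the junk value 0 at the pole.
   The iterates [iter n (mobius a b c) x] are the genuine ones up to the first
   time the trajectory of x hits the pole, and for all n outside [pole_set]. *)
Definition mobius {R : realType} (a b c x : R) : R := (x + a) / (b * x + c).

(* The condition [x != pole b c] discards the fixed point 0 that the junk
   value creates when the pole is 0. *)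
Definition mobius_fix {R : realType} (a b c : R) : set R :=
  [set x | x != pole b c /\ mobius a b c x = x].

(* The junk value does not enlarge this set: before the least n with
   f^n(x) = pole, the trajectory avoids the pole. *)
Definition pole_set {R : realType} (a b c : R) : set R :=
  [set x | exists n : nat, iter n (mobius a b c) x = pole b c].

Definition discr {R : realType} (a b c : R) : R :=
  (c - 1) ^+ 2 + 4 * a * b.

(* [sqrtC] is the principal complex square root: it is the nonnegative real
   root when 0 <= discr a b c, and purely imaginary when discr a b c < 0. *)
Definition alpha {R : realType} (a b c : R) : R[i] :=
  (1 + c%:C + sqrtC (discr a b c)%:C) / 2.

Definition beta {R : realType} (a b c : R) : R[i] :=
  (1 + c%:C - sqrtC (discr a b c)%:C) / 2.

(* [Num.sqrt] vanishes on negative reals; fix1 and fix2 are meaningful only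
   when 0 <= discr a b c. *)
Definition fix1 {R : realType} (a b c : R) : R :=
  (1 - c + Num.sqrt (discr a b c)) / (2 * b).

Definition fix2 {R : realType} (a b c : R) : R :=
  (1 - c - Num.sqrt (discr a b c)) / (2 * b).

Definition Kpoly {R : realType} (q : nat) (a b c : R) : R[i] :=
  \sum_(j < q) alpha a b c ^+ (q - j - 1) * beta a b c ^+ j.

Definition Kq {R : realType} (q : nat) : set (R * R * R) :=
  [set p | Kpoly q p.1.1 p.1.2 p.2 = 0].

Definition Kset {R : realType} : set (R * R * R) :=
  ~` \bigcup_(q in [set q : nat | (2 <= q)%N]) Kq q.

(* Main.v *)
Require Import Defs.
From mathcomp Require Import all_boot all_order all_algebra.
From mathcomp Require Import all_classical all_reals all_analysis.
From mathcomp Require Import complex.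
From mathcomp Require Import ring lra.

Local Open Scope classical_set_scope.
Local Open Scope ring_scope.
Local Open Scope complex_scope.

(* Let p, q be the fixed points of f.  When the discriminant is positive,
   (f x - p) / (f x - q) is (x - p) / (x - q) times (b q + c) / (b p + c),
   a ratio of the eigenvalues alpha = b x_1 + c and beta = b x_2 + c, so the
   iterates converge to the fixed point of the dominant eigenvalue; K_2 <> 0
   excludes |alpha| = |beta|.  When it vanishes, 1 / (f x - p) is 1 / (x - p)
   plus a nonzero constant.  When it is negative, an affine change of variable
   x = u + v tan y turns f into the rotation y |-> y + theta modulo pi, and
   K_q <> 0 for all q >= 2 means that theta / pi is irrational. *)

(** * Multiples of t modulo p *)

(* The induction step: if d is a nonzero multiple of t modulo p, then one of the
   two multiples of `|d| on either side of p is within `|d| / 2 of p. *)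
Lemma halving_multiple {R : realType} (p t : R) :
  0 < p -> (forall n m, (0 < n)%N -> n%:R * t != m%:~R * p) ->
  forall j, exists n m, (0 < n)%N /\ `|n%:R * t - m%:~R * p| <= p / 2 ^+ j.
Proof.
move=> p_gt0 irr; elim=> [|j [n [m [n_gt0 le_d]]]].
  exists 1%N, (Num.floor (t / p)); split=> //.
  have /andP[] := floor_itv (t / p).
  rewrite ler_pdivlMr // ltr_pdivrMr // intrD => h1 h2.
  by rewrite ger0_norm; lra.
have d_neq0 : n%:R * t - m%:~R * p != 0 by rewrite subr_eq0 irr.
set d := n%:R * t - m%:~R * p in le_d d_neq0.
have e_gt0 : 0 < `|d| by rewrite normr_gt0.
have /andP[] := truncn_itv (divr_ge0 (ltW p_gt0) (ltW e_gt0)).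
set k := Num.trunc _; rewrite ler_pdivlMr // ltr_pdivrMr // => h1 h2.
have k_gt0 : (0 < k)%N.
  rewrite truncn_gt0 ler_pdivlMr // mul1r (le_trans le_d) //.
  rewrite ler_pdivrMr ?exprn_gt0 // ler_peMr ?(ltW p_gt0) //.
  by rewrite exprn_ege1 // ler1n.
have half l : `|l%:R * `|d| - p| <= `|d| / 2 -> (0 < l)%N ->
    exists n m, (0 < n)%N /\ `|n%:R * t - m%:~R * p| <= p / 2 ^+ j.+1.
  (* Subtracting p with the sign of d makes the new residue l |d| - p up to sign. *)
  move=> hl l_gt0; exists (l * n)%N, (l%:Z * m + sgz d).
  rewrite muln_gt0 l_gt0 n_gt0; split=> //.
  have -> : (l * n)%:R * t - (l%:Z * m + sgz d)%:~R * p =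
      (sgz d)%:~R * (l%:R * `|d| - p).
    rewrite natrM intrD intrM -sgrEz mulrBr mulrCA -numEsg /d /=; ring.
  rewrite normrM -sgrEz normr_sg d_neq0 mul1r (le_trans hl) //.
  by rewrite exprS invfM; lra.
rewrite -natr1 in h2.
have [hr|hr] := lerP (p - k%:R * `|d|) (`|d| / 2).
  by apply: (half k) => //; rewrite distrC ger0_norm; lra.
by apply: (half k.+1) => //; rewrite -natr1 ger0_norm; lra.
Qed.

(** Some nonzero residue d is smaller than e by [halving_multiple]; its multiples advance in steps
    shorter than e, so one of them comes within e of y plus a multiple of p. *)
Lemma irrational_dense_half_orbit {R : realType} (p t : R) :
  0 < p -> (forall n m, (0 < n)%N -> n%:R * t != m%:~R * p) ->
  forall y e, 0 < e ->
  exists n m, (0 < n)%N /\ `|n%:R * t - m%:~R * p - y| < e.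
Proof.
move=> p_gt0 irr y e e_gt0.
have [j hj] : exists j, p / 2 ^+ j < e.
  (* This j exceeds p / e, and 2 ^ j exceeds j. *)
  exists (Num.trunc (p / e)).+1.
  rewrite ltr_pdivrMr ?exprn_gt0 // mulrC -ltr_pdivrMr //.
  have /andP[_ h] := truncn_itv (divr_ge0 (ltW p_gt0) (ltW e_gt0)).
  rewrite (lt_le_trans h) // -natrX ler_nat.
  exact/ltnW/ltn_expl.
have [n [m [n_gt0 le_d]]] := halving_multiple p t p_gt0 irr j.
have {le_d} lt_d : `|n%:R * t - m%:~R * p| < e by apply: le_lt_trans hj.
have step u z k : `|n%:R * u - k%:~R * p| < e -> 0 < n%:R * u - k%:~R * p ->
     exists n m, (0 < n)%N /\ `|n%:R * u - m%:~R * p - z| < e.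
  set d := _ - _ => + d_gt0; rewrite gtr0_norm // => d_lt.
  (* Shifting the target z by M periods brings it to at least d, so that the number l of steps of
     length d is positive. *)
  pose M := (Num.trunc ((`|z| + d) / p)).+1.
  have zM : d <= z + M%:R * p.
    have zd_ge0 : 0 <= `|z| + d by rewrite addr_ge0 // ltW.
    have := truncn_itv (divr_ge0 zd_ge0 (ltW p_gt0)).
    rewrite -/M ltr_pdivrMr // => /andP[_ hM].
    by have := ler_norm (- z); rewrite normrN; lra.
  have T_ge0 : 0 <= (z + M%:R * p) / d by rewrite divr_ge0 ?(ltW d_gt0) //; lra.
  have /andP[] := truncn_itv T_ge0.
  set l := Num.trunc _; rewrite ler_pdivlMr // ltr_pdivrMr // -natr1 => h1 h2.
  have l_gt0 : (0 < l)%N by rewrite truncn_gt0 ler_pdivlMr // mul1r.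
  exists (l * n)%N, (l%:Z * k + M%:Z); rewrite muln_gt0 l_gt0 n_gt0; split=> //.
  have -> : (l * n)%:R * u - (l%:Z * k + M%:Z)%:~R * p - z =
      l%:R * d - (z + M%:R * p).
    by rewrite natrM intrD intrM /d /=; ring.
  by rewrite distrC ger0_norm; lra.
have d_neq0 : n%:R * t - m%:~R * p != 0 by rewrite subr_eq0 irr.
move: (d_neq0); rewrite neq_lt => /orP[d_lt0|d_gt0]; last first.
  exact: (step t y m).
(* A negative residue becomes positive once t and the target y are both negated. *)
have opp : n%:R * - t - (- m)%:~R * p = - (n%:R * t - m%:~R * p).
  by rewrite intrN; ring.
have [||n' [m' [n'_gt0 h]]] := step (- t) (- y) (- m).
- by rewrite opp normrN.
- by rewrite opp oppr_gt0.
exists n', (- m'); split=> //; rewrite -normrN; congr (`|_| < e): h.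
by rewrite intrN; ring.
Qed.

(** * Periodicity and the eigenvalues *)

Lemma periodicz {U : zmodType} {V : Type} (f : U -> V) (T : U) :
  (forall x, f (x + T) = f x) -> forall m x, f (x + T *~ m) = f x.
Proof.
move=> fT; have fTn n x : f (x + T *+ n) = f x.
  by elim: n => [|n IH]; rewrite ?addr0 // mulrSr addrA fT.
by case=> n x; [exact: fTn|rewrite NegzE mulrNz -[LHS](fTn n.+1) subrK].
Qed.

Lemma de_moivre {R : realType} (t : R) n :
  (cos t +i* sin t) ^+ n = cos (n%:R * t) +i* sin (n%:R * t).
Proof.
elim: n => [|n IH]; first by rewrite mul0r cos0 sin0.
rewrite exprS IH -natr1 mulrDl mul1r addrC cosD sinD; simpc.
by congr (_ +i* _); ring.
Qed.

(** The product of alpha - beta and [Kpoly q] is alpha ^ q - beta ^ q. Equality of n-th powers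
    passes to the exponent q = 2 n, which is at least 2 even when n = 1. *)
Lemma Kset_neq {R : realType} (a b c : R) n :
  (a, b, c) \in Kset -> alpha a b c != beta a b c -> (0 < n)%N ->
  alpha a b c ^+ n != beta a b c ^+ n.
Proof.
rewrite inE /Kset => hK hab n_gt0; apply/eqP => hn; apply: hK.
exists (n * 2)%N => /=; first by case: n n_gt0 {hn}.
rewrite /Kq /= /Kpoly.
apply: (mulfI (x := alpha a b c - beta a b c)); first by rewrite subr_eq0.
rewrite mulr0 (eq_bigr (fun j : 'I_(n * 2) =>
   alpha a b c ^+ ((n * 2).-1 - j) * beta a b c ^+ j)) => [|j _].
  by rewrite -subrXX !exprM hn subrr.
by rewrite subnAC subn1.
Qed.

Lemma alpha_beta_real {R : realType} (a b c : R) : 0 <= discr a b c ->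
  alpha a b c = ((1 + c + Num.sqrt (discr a b c)) / 2)%:C /\
  beta a b c = ((1 + c - Num.sqrt (discr a b c)) / 2)%:C.
Proof.
move=> D_ge0; have sE : sqrtC (discr a b c)%:C = (Num.sqrt (discr a b c))%:C.
  by rewrite -[in LHS](sqr_sqrtr D_ge0) rmorphXn sqrCK // ler0c sqrtr_ge0.
by rewrite /alpha /beta sE
   !(rmorphM, rmorphB, rmorphD, rmorph1, fmorphV, rmorph_nat).
Qed.

Lemma normc_real {R : realType} (x : R) : `|x%:C| = `|x|%:C.
Proof. by rewrite normc_def /= expr0n addr0 sqrtr_sqr. Qed.

(** * Convergence to a real fixed point *)

Lemma denom_neq0 {R : realType} (a b c x : R) : b != 0 -> ~ pole_set a b c x ->
  forall n, b * iter n (mobius a b c) x + c != 0.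
Proof.
move=> b_neq0 hx n; apply/eqP => h; apply: hx; exists n.
apply: (mulfI b_neq0); rewrite /pole mulrN mulrCA divff // mulr1.
by apply/eqP; rewrite -addr_eq0 h.
Qed.

(* Vieta's formulas say that p and q are the two fixed points. *)
Lemma mobius_sub_fix {R : realType} (a b c p q x : R) :
  b * (p + q) = 1 - c -> b * p * q = - a -> b * x + c != 0 ->
  mobius a b c x - p = (b * q + c) * (x - p) / (b * x + c).
Proof.
move=> hS hP hx; rewrite /mobius.
have -> : a = - (b * p * q) by rewrite hP opprK.
have -> : c = 1 - b * (p + q) by rewrite hS; ring.
by field; move: hx; rewrite (_ : c = 1 - b * (p + q)) // hS; ring.
Qed.

Lemma cvg_mobius {R : realType} (a b c p q x : R) :
  b * (p + q) = 1 - c -> b * p * q = - a -> p != q ->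
  `|b * q + c| < `|b * p + c| -> x != q ->
  (forall n, b * iter n (mobius a b c) x + c != 0) ->
  iter n (mobius a b c) x @[n --> \oo] --> p.
Proof.
move=> hS hP pq hlt xq hx; set f := mobius a b c in hx *.
have nu_neq0 : b * p + c != 0 by rewrite -normr_gt0 (le_lt_trans _ hlt).
pose r := (b * q + c) / (b * p + c); pose g0 := (x - p) / (x - q).
have subp n : iter n.+1 f x - p =
    (b * q + c) * (iter n f x - p) / (b * iter n f x + c).
  by rewrite iterS; apply: mobius_sub_fix => //; exact: hx.
have subq n : iter n.+1 f x - q =
    (b * p + c) * (iter n f x - q) / (b * iter n f x + c).
  rewrite iterS; apply: mobius_sub_fix; rewrite ?[q + p]addrC //.
  by rewrite mulrAC.
have xq_neq0 n : iter n f x - q != 0.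
  elim: n => [|n IH]; first by rewrite subr_eq0.
  by rewrite subq !mulf_neq0 ?invr_neq0 ?hx.
have gE n : (iter n f x - p) / (iter n f x - q) = g0 * r ^+ n.
  elim: n => [|n IH]; first by rewrite expr0 mulr1.
  rewrite exprSr mulrA -IH subp subq /r.
  by field; rewrite nu_neq0 xq_neq0 hx.
have r_lt1 : `|r| < 1 by rewrite normrM normfV ltr_pdivrMr ?mul1r ?normr_gt0.
have g_cvg : g0 * r ^+ n @[n --> \oo] --> (0 : R).
  by rewrite -(mulr0 g0); apply: cvgMr; exact: cvg_expr.
(* The ratio in [gE] is solved for the iterate; it equals 1 only if p = q. *)
have xE n : iter n f x = (p - g0 * r ^+ n * q) / (1 - g0 * r ^+ n).
  have h1 : 1 - g0 * r ^+ n != 0.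
    rewrite -gE subr_eq0; apply: contraNneq pq => /esym/divr1_eq h.
    by move/addrI : h => /oppr_inj ->.
  apply: (mulIf h1); rewrite mulfVK // -gE.
  by field.
suff : (p - g0 * r ^+ n * q) / (1 - g0 * r ^+ n) @[n --> \oo] -->
    (p - 0 * q) / (1 - 0).
  by under eq_cvg do rewrite -xE; rewrite mul0r !subr0 divr1.
apply: cvgM.
  by apply: cvgB; [exact: cvg_cst|apply: cvgMl].
apply: cvgV; first by rewrite subr0 oner_eq0.
by apply: cvgB => //; exact: cvg_cst.
Qed.

Lemma cvg_parabolic {R : realType} (a b c p x : R) : b != 0 ->
  b * p *+ 2 = 1 - c -> b * p ^+ 2 = - a -> x != p ->
  b * p + c != 0 ->
  (forall n, b * iter n (mobius a b c) x + c != 0) ->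
  iter n (mobius a b c) x @[n --> \oo] --> p.
Proof.
move=> b_neq0 hS hP xp mu_neq0 hx; set f := mobius a b c in hx *.
have subp n : iter n.+1 f x - p =
    (b * p + c) * (iter n f x - p) / (b * iter n f x + c).
  rewrite iterS; apply: mobius_sub_fix; last exact: hx.
    by rewrite mulrDr -mulr2n.
  by rewrite -mulrA -expr2.
have xp_neq0 n : iter n f x - p != 0.
  elim: n => [|n IH]; first by rewrite subr_eq0.
  by rewrite subp !mulf_neq0 ?invr_neq0 ?hx.
(* Since b y + c = b (y - p) + (b p + c), dividing by (b p + c) (y - p) shows that each iteration
   adds k to 1 / (y - p). *)
pose k := b / (b * p + c).
have k_neq0 : k != 0 by rewrite mulf_neq0 ?invr_neq0.
have gE n : (iter n f x - p)^-1 = (x - p)^-1 + n%:R * k.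
  elim: n => [|n IH]; first by rewrite mul0r addr0.
  rewrite -natr1 mulrDl mul1r addrA -IH subp /k.
  by field; rewrite mu_neq0 xp_neq0 hx.
have : iter n f x - p @[n --> \oo] --> (0 : R).
  have inv0 : (n%:R)^-1 @[n --> \oo] --> (0 : R).
    apply/gtr0_cvgV0; last exact: cvgr_idn.
    by near=> n; rewrite ltr0n; near: n; exact: nbhs_infty_gt.
  (* This is the inverse of 1 / (x - p) + n k, with numerator and denominator divided by n. *)
  have : n%:R^-1 / (n%:R^-1 * (x - p)^-1 + k) @[n --> \oo] --> (0 : R).
    rewrite -[X in _ --> X](mul0r (0 * (x - p)^-1 + k)^-1).
    apply: cvgM => //; apply: cvgV; first by rewrite mul0r add0r.
    by apply: cvgD; [exact: cvgMl|exact: cvg_cst].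
  apply: cvg_trans; apply: near_eq_cvg; near=> n.
  have n_neq0 : (n%:R : R) != 0.
    by rewrite pnatr_eq0 -lt0n; near: n; exact: nbhs_infty_gt.
  rewrite -[in RHS](invrK (iter n f x - p)) gE.
  have -> : n%:R^-1 / (x - p) + k = n%:R^-1 * ((x - p)^-1 + n%:R * k).
    by rewrite mulrDr mulKf.
  by rewrite invfM invrK mulKf.
by move/(cvgD (cvg_cst p)); rewrite addr0; under eq_cvg do rewrite addrC subrK.
Unshelve. all: by end_near. Qed.

(** * Negative discriminant: conjugation to a rotation *)

(** The fixed points (1 - c +- i s) / (2 b) correspond to tan y = +- i, so in the variable tan y the
    map fixes +- i and is the addition formula for tan. Up to nonzero factors the denominator of f
    is cos (phi + theta), so staying off the pole keeps tan defined. *)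
Lemma mobius_tan {R : realType} (a b c s phi : R) :
  b != 0 -> 1 + c != 0 -> s ^+ 2 = - discr a b c -> cos phi != 0 ->
  let psi y := (1 - c) / (2 * b) + s / (2 * b) * tan y in
  let theta := atan (- s / (1 + c)) in
  b * psi phi + c != 0 ->
  cos (phi + theta) != 0 /\ mobius a b c (psi phi) = psi (phi + theta).
Proof.
move=> b_neq0 c_neq0 s2 cphi psi theta hx.
have ctheta : cos theta != 0.
  by rewrite gt_eqF // cos_gt0_pihalf // atan_gtNpi2 atan_ltpi2.
have ttheta : tan theta = - s / (1 + c) by rewrite atanK.
have denomE : b * psi phi + c = (1 + c) / 2 * (1 - tan phi * tan theta).
  by rewrite /psi ttheta; field; rewrite c_neq0 b_neq0.
have tt_neq1 : 1 - tan phi * tan theta != 0.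
  by move: hx; rewrite denomE mulf_eq0 negb_or => /andP[].
split.
  rewrite cosD; have -> : cos phi * cos theta - sin phi * sin theta =
      cos phi * cos theta * (1 - tan phi * tan theta).
    by rewrite /tan; field; rewrite cphi ctheta.
  by rewrite !mulf_neq0.
have aE : a = - (s ^+ 2 + (c - 1) ^+ 2) / (4 * b).
  by rewrite s2 /discr; field.
rewrite /mobius denomE {1}/psi /psi tanD // aE.
move: tt_neq1; rewrite ttheta => tt.
have ttE : 1 - tan phi * (- s / (1 + c)) = (1 + c - tan phi * - s) / (1 + c).
  by field.
by field; move: tt; rewrite ttE mulf_eq0 negb_or b_neq0 c_neq0 => /andP[->].
Qed.

Lemma dense_mobius_orbit {R : realType} (a b c x : R) :
  (a, b, c) \in Kset -> b != 0 -> discr a b c < 0 -> ~ pole_set a b c x ->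
  dense [set iter n (mobius a b c) x | n in [set n : nat | (1 <= n)%N]].
Proof.
move=> hK b_neq0 D_lt0 /(denom_neq0 _ _ _ _ b_neq0) hx.
set f := mobius a b c in hx *.
pose s := Num.sqrt (- discr a b c).
have s_neq0 : s != 0 by rewrite sqrtr_eq0 -ltNge oppr_gt0.
have s2 : s ^+ 2 = - discr a b c by rewrite sqr_sqrtr // oppr_ge0 ltW.
(* Which of i s and - i s [sqrtC] selects is left open: e is s or - s. *)
have [e [e2 alphaE betaE]] : exists e : R, [/\ e ^+ 2 = s ^+ 2,
    alpha a b c = ((1 + c) +i* e) / 2 & beta a b c = ((1 + c) -i* e) / 2].
  have : (sqrtC (discr a b c)%:C) ^+ 2 = (0 +i* s) ^+ 2.
    by rewrite sqrtCK expr2; simpc; rewrite -expr2 s2 opprK.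
  have cE : 1 + c%:C = (1 + c)%:C :> R[i] by rewrite rmorphD rmorph1.
  rewrite /alpha /beta cE => /eqP; rewrite eqf_sqr => /orP[]/eqP ->.
    by exists s; split=> //; congr (_ / _); simpc.
  by exists (- s); rewrite sqrrN; split=> //; congr (_ / _); simpc.
have e_neq0 : e != 0 by rewrite -sqrf_eq0 e2 sqrf_eq0.
have alpha_neq_beta : alpha a b c != beta a b c.
  rewrite alphaE betaE (inj_eq (mulIf _)) ?invr_eq0 ?pnatr_eq0 //.
  by rewrite eq_complex /= eqxx eq_sym eqNr.
have c_neq0 : 1 + c != 0.
  (* If 1 + c = 0 then alpha = - beta, so their squares agree. *)
  apply: contraNneq (Kset_neq _ _ _ 2 hK alpha_neq_beta isT) => c0.
  by rewrite -subr_eq0 subr_sqr alphaE betaE c0 -mulrDl; simpc.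
have cos_atan_neq0 y : cos (atan y) != 0 :> R.
  by rewrite gt_eqF // cos_gt0_pihalf // atan_gtNpi2 atan_ltpi2.
pose theta := atan (- s / (1 + c)).
pose psi y := (1 - c) / (2 * b) + s / (2 * b) * tan y.
(* The eigenvalues have arguments theta and - theta modulo pi, so if n theta is a multiple of pi,
   their n-th powers agree. *)
have irr n m : (0 < n)%N -> n%:R * theta != m%:~R * pi.
  move=> n_gt0.
  apply: contraNneq (Kset_neq _ _ _ _ hK alpha_neq_beta n_gt0) => h.
  have sin_eq0 : sin (n%:R * theta) = 0.
    (* A shift by pi flips the sign of sin; squaring makes pi a period. *)
    have sin2_pi y : sin (y + pi) ^+ 2 = sin y ^+ 2 :> R
      by rewrite sinDpi sqrrN.
    have := periodicz (fun y => sin y ^+ 2) _ sin2_pi m 0.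
    rewrite add0r -mulrzl -h {1}sin0 expr0n => /eqP.
    by rewrite sqrf_eq0 => /eqP.
  (* The common modulus up to sign: [atan] makes cos theta positive, while 1 + c may be negative. *)
  pose r := (1 + c) / cos theta.
  have ctheta : cos theta != 0 := cos_atan_neq0 _.
  have polar : (1 + c) -i* s = r%:C * (cos theta +i* sin theta).
    simpc; congr (_ +i* _); first by rewrite divfK.
    by rewrite /r mulrAC -mulrA -/(tan theta) atanK; field.
  have polarN : (1 + c) +i* s = r%:C * (cos (- theta) +i* sin (- theta)).
    rewrite cosN sinN -[s]opprK.
    by move/(congr1 (@conjc R)) : polar; simpc => ->.
  have eq_pow : ((1 + c) -i* s) ^+ n = ((1 + c) +i* s) ^+ n.
    by rewrite polar polarN !exprMn !de_moivre mulrN cosN sinN sin_eq0 oppr0.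
  rewrite alphaE betaE !exprMn.
  by move/eqP: e2; rewrite eqf_sqr => /orP[]/eqP ->; rewrite ?opprK eq_pow.
pose phi := atan ((x - (1 - c) / (2 * b)) / (s / (2 * b))).
have b2_neq0 : 2 * b != 0 by rewrite mulf_neq0 ?pnatr_eq0.
have psi_atan z : psi (atan ((z - (1 - c) / (2 * b)) / (s / (2 * b)))) = z.
  by rewrite /psi atanK; field; rewrite s_neq0 b_neq0.
have orbit n : cos (phi + n%:R * theta) != 0 /\
    iter n f x = psi (phi + n%:R * theta).
  elim: n => [|n [IH1 IH2]]; first
    by rewrite mul0r addr0 psi_atan; split=> //; exact: cos_atan_neq0.
  rewrite -natr1 mulrDl mul1r addrA iterS IH2; apply: mobius_tan => //.
  by have := hx n; rewrite IH2.
move=> O [z Oz] Oopen.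
(* The point z of O pulls back to y, and by continuity of psi it suffices to bring the angles near y
   modulo pi. *)
set y := atan ((z - (1 - c) / (2 * b)) / (s / (2 * b))).
have /nbhs_ballP[e' /= e'_gt0 he] : \forall w \near y, O (psi w).
  have : {for y, continuous psi}.
    rewrite /psi; apply: cvgD; first exact: cvg_cst.
    apply: cvgMr; exact: (continuous_tan (cos_atan_neq0 _)).
  by apply; rewrite psi_atan; exact: open_nbhs_nbhs.
have [n [m [n_gt0 hn]]] :=
  irrational_dense_half_orbit _ _ (pi_gt0 R) irr (y - phi) _ e'_gt0.
exists (iter n f x); split; last by exists n.
have -> : iter n f x = psi (phi + n%:R * theta - m%:~R * pi).
  rewrite (orbit n).2 /psi; congr (_ + _ * _).
  by rewrite -[LHS](periodicz _ _ (@tanDpi R) (- m)) mulrNz mulrzl.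
apply: he; rewrite /ball /= distrC; congr (`|_| < e'): hn; ring.
Qed.

(** * The three cases of the discriminant *)

(** The quadratic is p (b p + c) = p + a, the fixed-point equation cleared of its denominator; b p +
    c != 0 keeps p off the pole, as [mobius_fix] demands. *)
Lemma neq_fix {R : realType} (a b c p x : R) :
  b != 0 -> b * p ^+ 2 + (c - 1) * p = a -> b * p + c != 0 ->
  ~ mobius_fix a b c x -> x != p.
Proof.
move=> b_neq0 hp den_neq0 hx; apply/eqP => xp; apply: hx; rewrite xp; split.
  apply: contraNneq den_neq0 => ->.
  by rewrite /pole mulrN mulrCA divff // mulr1 addNr.
by apply: (mulIf den_neq0); rewrite /mobius mulfVK // -hp; ring.
Qed.

Theorem theorem2 (R : realType) (a b c : R)
    (habc : (a, b, c) \in Kset) (hb : b != 0) (hdet : a * b - c != 0) :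
  [/\ (* 1) *)
      0 < discr a b c ->
      (`|alpha a b c / beta a b c| < 1 \/ 1 < `|alpha a b c / beta a b c|) /\
      forall x : R, ~ (mobius_fix a b c `|` pole_set a b c) x ->
        (`|alpha a b c / beta a b c| < 1 ->
           iter n (mobius a b c) x @[n --> \oo] --> fix2 a b c) /\
        (1 < `|alpha a b c / beta a b c| ->
           iter n (mobius a b c) x @[n --> \oo] --> fix1 a b c),
      (* 2) *)
      discr a b c = 0 ->
      forall x : R, ~ (mobius_fix a b c `|` pole_set a b c) x ->
        iter n (mobius a b c) x @[n --> \oo] --> fix1 a b c /\
        fix1 a b c = (1 - c) / (2 * b)
    & (* 3) *)
      discr a b c < 0 ->
      forall x : R, ~ (mobius_fix a b c `|` pole_set a b c) x ->
        dense [set iter n (mobius a b c) x | n in [set n : nat | (1 <= n)%N]]].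
Proof.
split.
- move=> D_gt0; set s := Num.sqrt (discr a b c).
  have s_gt0 : 0 < s by rewrite sqrtr_gt0.
  have s2 : s ^+ 2 = discr a b c by rewrite sqr_sqrtr // ltW.
  have aE : a = (s ^+ 2 - (c - 1) ^+ 2) / (4 * b).
    by rewrite s2 /discr; field.
  have [alphaE betaE] := alpha_beta_real a b c (ltW D_gt0).
  have den1 : (1 + c + s) / 2 = b * fix1 a b c + c.
    by rewrite /fix1 -/s; field.
  have den2 : (1 + c - s) / 2 = b * fix2 a b c + c.
    by rewrite /fix2 -/s; field.
  rewrite -/s den1 in alphaE; rewrite -/s den2 in betaE.
  (* The product of the eigenvalues is the determinant c - a b. *)
  have : (b * fix1 a b c + c) * (b * fix2 a b c + c) != 0.
    rewrite -den1 -den2; apply: contraNneq hdet => h.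
    by rewrite -oppr_eq0 -h aE; apply/eqP; field.
  rewrite mulf_eq0 negb_or => /andP[A_neq0 B_neq0].
  have sum_fix : b * (fix1 a b c + fix2 a b c) = 1 - c.
    by rewrite /fix1 /fix2; field.
  have prod_fix : b * fix1 a b c * fix2 a b c = - a.
    by rewrite /fix1 /fix2 -/s aE; field.
  have fix_neq : fix1 a b c != fix2 a b c.
    apply: contraTneq s_gt0 => h; suff -> : s = 0 by rewrite ltxx.
    by have := den1; rewrite h -den2; lra.
  have normE : `|alpha a b c / beta a b c| =
      (`|b * fix1 a b c + c| / `|b * fix2 a b c + c|)%:C.
    by rewrite alphaE betaE -fmorph_div normc_real normf_div.
  have ab_neq : alpha a b c != beta a b c.
    rewrite alphaE betaE (inj_eq (fmorph_inj _)) (inj_eq (addIr _)).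
    by rewrite (inj_eq (mulfI hb)).
  have lt1E : (`|alpha a b c / beta a b c| < 1) =
      (`|b * fix1 a b c + c| < `|b * fix2 a b c + c|).
    by rewrite normE -(rmorph1 (real_complex R)) ltcR ltr_pdivrMr
      ?normr_gt0 // mul1r.
  have gt1E : (1 < `|alpha a b c / beta a b c|) =
      (`|b * fix2 a b c + c| < `|b * fix1 a b c + c|).
    by rewrite normE -(rmorph1 (real_complex R)) ltcR ltr_pdivlMr
      ?normr_gt0 // mul1r.
  rewrite lt1E gt1E; split.
    apply/orP; rewrite -neq_lt.
    (* Real eigenvalues of equal modulus have equal squares. *)
    apply: contraNneq (Kset_neq _ _ _ 2 habc ab_neq isT) => h.
    rewrite alphaE betaE -!rmorphXn /=.
    by rewrite -real_normK ?num_real // h real_normK ?num_real.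
  move=> x /not_orP[xfix /(denom_neq0 _ _ _ _ hb) hx].
  have aE1 : b * fix1 a b c ^+ 2 + (c - 1) * fix1 a b c = a.
    by rewrite -[RHS]opprK -prod_fix -opprB -sum_fix; ring.
  have aE2 : b * fix2 a b c ^+ 2 + (c - 1) * fix2 a b c = a.
    by rewrite -[RHS]opprK -prod_fix -opprB -sum_fix; ring.
  split=> hlt.
    apply: (cvg_mobius _ _ _ _ (fix1 a b c)) hx => //.
    - by rewrite addrC.
    - by rewrite mulrAC.
    - by rewrite eq_sym.
    - exact: neq_fix xfix.
  by apply: (cvg_mobius _ _ _ _ (fix2 a b c)) hx => //; exact: neq_fix xfix.
- move=> D0 x /not_orP[xfix /(denom_neq0 _ _ _ _ hb) hx].
  have fix1E : fix1 a b c = (1 - c) / (2 * b).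
    by rewrite /fix1 D0 sqrtr0 addr0.
  split=> //; rewrite fix1E.
  have aE : a = - (c - 1) ^+ 2 / (4 * b).
    apply: (mulfI (x := 4 * b)); first by rewrite mulf_neq0 ?pnatr_eq0.
    rewrite mulrCA divff ?mulf_neq0 ?pnatr_eq0 // mulr1.
    by move: D0; rewrite /discr; lra.
  (* The square of this double eigenvalue is c - a b. *)
  have den_neq0 : b * ((1 - c) / (2 * b)) + c != 0.
    rewrite -sqrf_eq0; apply: contraNneq hdet => h.
    by rewrite -oppr_eq0 -h aE; apply/eqP; field.
  apply: cvg_parabolic hx => //.
  + by field; rewrite hb.
  + by rewrite [in RHS]aE; field; rewrite hb.
  + apply: neq_fix xfix => //; by rewrite [RHS]aE; field.
- by move=> D_lt0 x /not_orP[_ hx]; exact: dense_mobius_orbit.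
Qed.
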